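(* Let $\{\mathbf u^{(k)}\}$ be the sequence generated, from a given initial guess $\mathbf u^{(0)}$, by the iteration $\mathbf u^{(k+1)}=\mathbf u^{(k)}+\mathbf B(\mathbf f-\mathbf A\mathbf u^{(k)})$, where $\mathbf A$ is the finite element stiffness matrix and $\mathbf B$ is a symmetric matrix. Let $\rho_{\mathrm{err}}:=\rho(\mathbf I-\mathbf B\mathbf A)=\|\mathbf I-\mathbf B\mathbf A\|_2$ be the spectral radius of the error propagation matrix $\mathbf I-\mathbf B\mathbf A$. Then the algebraic error $\mathbf e^{(k)}:=\mathbf u-\mathbf u^{(k)}$, where $\mathbf u$ is the solution of $\mathbf A\mathbf u=\mathbf f$, satisfies $$\|\mathbf e^{(k+1)}\|_{\mathbf A}\le\frac{\rho_{\mathrm{err}}}{1-\rho_{\mathrm{err}}}\,\|\mathbf u^{(k+1)}-\mathbf u^{(k)}\|_{\mathbf A},$$ or, in finite element function form, $$\|u_{\mathcal T}-u_{\mathcal T}^{(k+1)}\|_A\le\frac{\rho_{\mathrm{err}}}{1-\rho_{\mathrm{err}}}\,\|u_{\mathcal T}^{(k+1)}-u_{\mathcal T}^{(k)}\|_A .$$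
   Context: $\Omega\subset\mathbb R^d$ ($d=2,3$) is a bounded polygonal/polyhedral domain with a quasi-uniform and regular simplicial triangulation $\mathcal T$, and $\mathcal S^1=\{v\in H^1(\Omega): v|_K\in P_1(K)\ \forall K\in\mathcal T\}$, with $P_1(K)$ the polynomials of degree at most $1$ on $K$. The problem is $-\nabla\cdot(A\nabla u)=f$ in $\Omega$, $u=g$ on $\partial\Omega$, where the scalar diffusion coefficient $A$ and the datum $f$ are piecewise constant on $\mathcal T$ and $g$ is the trace of a function in $\mathcal S^1$. $H^1_g(\Omega)=\{v\in H^1(\Omega):v=g\text{ on }\partial\Omega\}$, $(\cdot,\cdot)$ is the $L^2(\Omega)$ inner product, and $\|v\|_A^2=(A\nabla v,\nabla v)$. The finite element approximation $u_{\mathcal T}\in\mathcal S^1\cap H^1_g(\Omega)$ satisfies $(A\nabla u_{\mathcal T},\nabla v)=(f,v)$ for all $v\in\mathcal S^1\cap H^1_0(\Omega)$. With $\phi_{z_i}$ the Lagrange nodal basis functions of $\mathcal S^1$ associated with the interior vertices $z_i$, the discrete problem is written as $\mathbf A\mathbf u=\mathbf f$, where $\mathbf A[i,j]=(A\nabla\phi_{z_j},\nabla\phi_{z_i})$ (symmetric positive definite), $\mathbf f[i]=(f,\phi_{z_i})$, and $\mathbf u$ is the vector representation of $u_{\mathcal T}$. $\mathbf u^{(k)}$ is the vector representation of the $k$-th iterate $u_{\mathcal T}^{(k)}$, $k=0,1,\dots$. The vector energy norm is $\|\mathbf v\|_{\mathbf A}=\sqrt{\mathbf A\mathbf v\cdot\mathbf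 v}$. $\|\cdot\|_2$ denotes the Euclidean norm of a vector and, for a matrix $\mathbf M$, $\|\mathbf M\|_2=\sup_{\|\mathbf v\|_2=1}\|\mathbf M\mathbf v\|_2$; $\rho(\mathbf M)$ denotes the spectral radius.
   Formalization: The assumption ρ_err < 1 is added (the bound fails for ρ_err > 1 and is undefined at 1), and for nonzero g the load vector f includes the contribution of the boundary values, without which Au = f would not represent u_T. *)

(* Defs.v *)
From HB Require Import structures.
From mathcomp Require Import all_boot all_order all_algebra.
From mathcomp Require Import complex.
From mathcomp Require Import all_classical all_reals all_analysis.

Set Implicit Arguments.
Unset Strict Implicit.
Unset Printing Implicit Defensive.

Import Order.TTheory GRing.Theory Num.Theory.
Import numFieldNormedType.Exports.

Local Open Scope classical_set_scope.
Local Open Scope ring_scope.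

Section vectors.
Context {R : realType}.

Definition dotr n (x y : 'rV[R]_n) : R := \sum_i x ord0 i * y ord0 i.

Definition enorm n (x : 'rV[R]_n) : R := Num.sqrt (dotr x x).

Definition dotc n (x y : 'cV[R]_n) : R := \sum_i x i ord0 * y i ord0.

Definition norm2 n (x : 'cV[R]_n) : R := Num.sqrt (dotc x x).

Definition energy_norm n (A : 'M[R]_n) (v : 'cV[R]_n) : R :=
  Num.sqrt (dotc (A *m v) v).

Definition opnorm2 n (M : 'M[R]_n) : R :=
  sup [set norm2 (M *m v) | v in [set v | norm2 v = 1]].

(* The eigenvalues are the complex ones, M being arbitrary. *)
Definition spectral_radius n (M : 'M[R]_n) : R :=
  sup [set r : R | exists2 lambda : R[i],
         eigenvalue (map_mx (real_complex R) M) lambda &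
         r = ComplexField.Normc.normc lambda].

End vectors.

Section product_step.
Context {d0} {T : measurableType d0} {R : realType} (n : nat).
Variables (m0 : {sigma_finite_measure set T -> \bar R})
          (m : {sigma_finite_measure set (n.-tuple T) -> \bar R}).

Definition tcons (p : T * n.-tuple T) : n.+1.-tuple T :=
  [the n.+1.-tuple T of p.1 :: p.2].

Lemma measurable_tcons : measurable_fun [set: T * n.-tuple T] tcons.
Proof. by apply: measurable_cons; [exact: measurable_fst|exact: measurable_snd]. Qed.

Definition product_step : set (n.+1.-tuple T) -> \bar R :=
  pushforward (m0 \x m)%E tcons.

Let product_step0 : product_step set0 = 0%E.
Proof. by rewrite /product_step /pushforward preimage_set0 measure0. Qed.

Let product_step_ge0 A : (0 <= product_step A)%E.
Proof. by rewrite /product_step /pushforward; exact: measure_ge0. Qed.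

Let product_step_sigma_additive : semi_sigma_additive product_step.
Proof.
move=> F mF tF mUF; rewrite /product_step /pushforward preimage_bigcup.
have mpre A : measurable A -> measurable (tcons @^-1` A).
  by move=> mA; rewrite -[X in measurable X]setTI; exact: measurable_tcons.
apply: measure_semi_sigma_additive.
- by move=> k; exact: mpre.
- apply/trivIsetP => /= i j _ _ ij; rewrite -preimage_setI.
  by move/trivIsetP : tF => /(_ _ _ _ _ ij) ->//; rewrite preimage_set0.
- by rewrite -preimage_bigcup; exact: mpre.
Qed.

HB.instance Definition _ := isMeasure.Build _ _ _ product_step
  product_step0 product_step_ge0 product_step_sigma_additive.

Let product_step_sigma_finite : sigma_finite setT product_step.
Proof.
have /sigma_finiteP[F [TF ndF Foo]] := sigma_finiteT m0.
have /sigma_finiteP[G [TG ndG Goo]] := sigma_finiteT m.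
pose uncons (x : n.+1.-tuple T) : T * n.-tuple T :=
  (thead x, [tuple of behead x]).
have tconsK : cancel tcons uncons.
  by move=> [b t]; congr pair => //; apply: val_inj.
have muncons : measurable_fun setT uncons.
  by apply: measurable_fun_pair;
    [exact: measurable_tnth|exact: measurable_behead].
exists (fun k => uncons @^-1` (F k `*` G k)).
  rewrite -preimage_bigcup (_ : \bigcup_i _ = setT) ?preimage_setT//.
  apply/seteqP; split => // -[x y] _.
  have [i _ Fix] : (\bigcup_i F i) x by rewrite -TF.
  have [j _ Gjy] : (\bigcup_i G i) y by rewrite -TG.
  exists (maxn i j) => //; split => /=.
  - by move: x Fix; exact/subsetPset/ndF/leq_maxl.
  - by move: y Gjy; exact/subsetPset/ndG/leq_maxr.
move=> k; have [mF Fk] := Foo k; have [mG Gk] := Goo k; split.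
  by rewrite -[X in measurable X]setTI; apply: muncons => //; exact: measurableX.
rewrite /product_step /pushforward -comp_preimage.
rewrite (_ : uncons \o tcons = id); last by apply/funext => x; exact: tconsK.
by rewrite preimage_id product_measure1E// lte_mul_pinfty// ge0_fin_numE.
Qed.

HB.instance Definition _ := Measure_isSigmaFinite.Build _ _ _ product_step
  product_step_sigma_finite.

End product_step.

Section lebesgue_tuple.
Context {R : realType}.
Local Notation RT := (measurableTypeR R).

(* Lebesgue measure on R^n, as the iterated product of the one on R *)
Fixpoint lebesgue_tuple n :
    {sigma_finite_measure set (n.-tuple RT) -> \bar R} :=
  match n with
  | 0 => @dirac _ (0.-tuple RT) [tuple] R
  | n'.+1 => product_step (@lebesgue_measure R) (lebesgue_tuple n')
  end.

End lebesgue_tuple.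

Section functions.
Context {R : realType} {d : nat}.
Local Notation V := 'rV[R]_d.
Local Notation RT := (measurableTypeR R).

(* Row vectors carry the topology of R^d, tuples its measurable structure. *)
Definition row_of (t : d.-tuple RT) : V := \row_i tnth t i.

Definition integral_on (D : set V) (f : V -> R) : R :=
  \int[lebesgue_tuple d]_(t in row_of @^-1` D) f (row_of t).

Definition partial (i : 'I_d) (v : V -> R) (x : V) : R :=
  'D_(delta_mx ord0 i) v x.

Definition grad (v : V -> R) (x : V) : V := \row_i partial i v x.

Definition smooth (v : V -> R) : Prop :=
  forall (s : seq 'I_d) (x : V), differentiable (foldr partial v s) x.

Definition test_function (Om : set V) (v : V -> R) : Prop :=
  smooth v /\
  exists K : set V, [/\ compact K, K `<=` Om & forall x, ~ K x -> v x = 0].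

Definition L2 (Om : set V) (v : V -> R) : Prop :=
  measurable_fun (row_of @^-1` Om) (v \o row_of : d.-tuple RT -> RT) /\
  (\int[lebesgue_tuple d]_(t in row_of @^-1` Om)
     ((v (row_of t)) ^+ 2)%:E < +oo)%E.

Definition weak_gradient (Om : set V) (v : V -> R) (G : V -> V) : Prop :=
  forall (i : 'I_d) (psi : V -> R), test_function Om psi ->
    integral_on Om (fun x => v x * partial i psi x) =
    - integral_on Om (fun x => G x ord0 i * psi x).

Definition H1 (Om : set V) (v : V -> R) : Prop :=
  L2 Om v /\
  exists2 G : V -> V, weak_gradient Om v G &
                      forall i, L2 Om (fun x => G x ord0 i).

Definition boundary (Om : set V) : set V := closure Om `\` interior Om.

End functions.

(* A cell is the set of (the indices of) its vertices *)

Record mesh (R : realType) (d : nat) := Mesh {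
  nvert : nat;
  vtx : 'I_nvert -> 'rV[R]_d;
  cells : {set {set 'I_nvert}} }.

Section meshes.
Context {R : realType} {d : nat}.
Local Notation V := 'rV[R]_d.
Implicit Types (T : mesh R d) (Om : set V).

Definition hull T (S : {set 'I_(nvert T)}) : set V :=
  [set x | exists w : 'I_(nvert T) -> R,
     [/\ forall i, 0 <= w i, \sum_(i in S) w i = 1 &
         x = \sum_(i in S) w i *: vtx i]].

Definition affinely_independent T (S : {set 'I_(nvert T)}) : Prop :=
  forall c : 'I_(nvert T) -> R,
    \sum_(i in S) c i = 0 -> \sum_(i in S) c i *: vtx i = 0 ->
    forall i, i \in S -> c i = 0.

Definition simplicial T : Prop :=
  forall K, K \in cells T -> #|K| = d.+1 /\ affinely_independent K.

Definition carrier T : set V := \bigcup_(K in [set` cells T]) hull K.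

(* The third clause excludes slits. *)
Definition polyhedral_domain Om : Prop :=
  [/\ Om !=set0 /\ bounded_set Om, open Om /\ connected Om,
      interior (closure Om) = Om &
      exists T : mesh R d, simplicial T /\ closure Om = carrier T].

Definition triangulation Om T : Prop :=
  [/\ injective (@vtx R d T),
      forall z : 'I_(nvert T), exists2 K, K \in cells T & z \in K,
      simplicial T,
      (forall K K', K \in cells T -> K' \in cells T ->
         hull K `&` hull K' = hull (K :&: K')) &
      closure Om = carrier T].

Definition diam (K : set V) : R :=
  sup [set r : R | exists x y, [/\ K x, K y & r = enorm (x - y)]].

Definition inradius (K : set V) : R :=
  sup [set r : R | exists c, forall x, enorm (x - c) <= r -> K x].

Definition shape_regular T (gamma : R) : Prop :=
  forall K, K \in cells T -> diam (hull K) <= gamma * inradius (hull K).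

Definition quasi_uniform T (sigma : R) : Prop :=
  forall K K', K \in cells T -> K' \in cells T ->
    diam (hull K) <= sigma * diam (hull K').

Definition piecewise_constant T (a : V -> R) : Prop :=
  forall K, K \in cells T -> exists c, forall x, interior (hull K) x -> a x = c.

Definition P1 (K : set V) (v : V -> R) : Prop :=
  exists (b : R) (g : V), forall x, K x -> v x = b + dotr g x.

Definition S1 Om T (v : V -> R) : Prop :=
  H1 Om v /\ forall K, K \in cells T -> P1 (hull K) v.

(* S^1 cap H^1_g.  A member of S1 agrees with an affine function on each closed
   element, hence is continuous on closure Om, and its trace is its
   restriction to the boundary. *)
Definition S1g Om T (g v : V -> R) : Prop :=
  S1 Om T v /\ forall x, boundary Om x -> v x = g x.

(* Om up to a Lebesgue null set: the points of Om at which piecewise constant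
   functions and gradients of members of S1 (whose classical gradient is there
   their weak gradient) are specified *)
Definition off_skeleton T : set V :=
  \bigcup_(K in [set` cells T]) interior (hull K).

Definition inner T (f v : V -> R) : R :=
  integral_on (off_skeleton T) (fun x => f x * v x).

Definition aform T (a v w : V -> R) : R :=
  integral_on (off_skeleton T) (fun x => a x * dotr (grad v x) (grad w x)).

Definition fun_energy_norm T (a v : V -> R) : R := Num.sqrt (aform T a v v).

Definition galerkin_solution Om T (a f g u : V -> R) : Prop :=
  S1g Om T g u /\
  forall v, S1g Om T (fun=> 0) v -> aform T a u v = inner T f v.

Definition lagrange_basis Om T (phi : 'I_(nvert T) -> V -> R) : Prop :=
  forall z, S1 Om T (phi z) /\ forall z', phi z (vtx z') = (z' == z)%:R.

Definition interior_vertices Om T : {set 'I_(nvert T)} :=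
  finset (fun z => vtx z \in Om).

Definition nint Om T : nat := #|interior_vertices Om T|.

Definition ivtx Om T (i : 'I_(nint Om T)) : 'I_(nvert T) := enum_val i.

Definition stiffness Om T (a : V -> R) (phi : 'I_(nvert T) -> V -> R) :
    'M[R]_(nint Om T) :=
  \matrix_(i, j) aform T a (phi (ivtx j)) (phi (ivtx i)).

(* The sum is the contribution of the prescribed values at the boundary
   vertices; it vanishes for g = 0, see load_homogeneous. *)
Definition load Om T (a f g : V -> R) (phi : 'I_(nvert T) -> V -> R) :
    'cV[R]_(nint Om T) :=
  \col_i (inner T f (phi (ivtx i)) -
          \sum_(z | z \notin interior_vertices Om T)
             g (vtx z) * aform T a (phi z) (phi (ivtx i))).

Lemma load_homogeneous Om T (a f : V -> R) (phi : 'I_(nvert T) -> V -> R) :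
  load Om a f (fun=> 0) phi = \col_i inner T f (phi (ivtx i)).
Proof.
apply/colP => i; rewrite !mxE big1 ?subr0// => z _.
by rewrite mul0r.
Qed.

(* The function with boundary values g whose vector representation is c *)
Definition fe_function Om T (g : V -> R) (phi : 'I_(nvert T) -> V -> R)
    (c : 'cV[R]_(nint Om T)) : V -> R :=
  fun x => \sum_i c i ord0 * phi (ivtx i) x +
           \sum_(z | z \notin interior_vertices Om T) g (vtx z) * phi z x.

End meshes.

(* Main.v *)
(** The matrix [A] is symmetric positive semidefinite, so [A = L L^*] for some [L],
    and [E = I - B A] satisfies [L^* E = S L^*] with [S = I - L^* B L] Hermitian.
    As [S] has the eigenvalues of [E], the energy norm of [E v] is at most
    [rho(E)] times that of [v], and [rho(E) <= ||E||_2]; the triangle inequality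
    [||e_k|| <= ||e_(k+1)|| + ||u_(k+1) - u_k||] then gives the vector form.
    The function form is the vector form for the vector of interior nodal values
    of [uT], once this vector is known to solve the linear system.  This requires
    that the basis functions of the interior vertices vanish on the boundary of
    [Om]: a point where such a function is positive is interior to the closure
    of [Om], as a homothety centred at the vertex shows. *)
Require Import Defs.
From HB Require Import structures.
From mathcomp Require Import all_boot all_order all_algebra.
From mathcomp Require Import complex.
From mathcomp Require Import all_classical all_reals all_analysis.
From mathcomp Require Import measurable_realfun ring lra.

Set Implicit Arguments.
Unset Strict Implicit.
Unset Printing Implicit Defensive.

Import Order.TTheory GRing.Theory Num.Theory.
Import numFieldNormedType.Exports.

Local Open Scope classical_set_scope.
Local Open Scope ring_scope.

(** * Hermitian matrices and eigenvalues *)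

Section hermitian_matrices.
Variable C : numClosedFieldType.
Local Open Scope sesquilinear_scope.

Definition sqnorm n (w : 'cV[C]_n) : C := (w^t* *m w) ord0 ord0.

Lemma sqnormE n (w : 'cV[C]_n) : sqnorm w = \sum_i `|w i ord0| ^+ 2.
Proof.
by rewrite /sqnorm mxE; apply: eq_bigr => i _; rewrite !mxE normCKC.
Qed.

Lemma sqnorm_ge0 n (w : 'cV[C]_n) : 0 <= sqnorm w.
Proof. by rewrite sqnormE sumr_ge0// => i _; rewrite exprn_ge0. Qed.

Lemma sqnorm_unitary n (Q : 'M[C]_n) (w : 'cV[C]_n) : Q \is unitarymx ->
  sqnorm (Q *m w) = sqnorm w.
Proof.
move=> Qu; rewrite /sqnorm trmx_mul map_mxM mulmxA -(mulmxA _ (Q^t*)).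
by rewrite -(invmx_unitary Qu) mulVmx ?unitarymx_unit// mulmx1.
Qed.

Lemma hermitian_normal n (S : 'M[C]_n) : S^t* = S -> S \is normalmx.
Proof. by move=> hS; apply/normalmxP; rewrite hS. Qed.

(** [eigenvalue] refers to row vectors: with [S = Q^-1 D Q], row [i] of [Q] is an eigenvector,
    nonzero because [Q] is invertible. *)
Lemma spectral_diag_eigenvalue n (S : 'M[C]_n) i : S \is normalmx ->
  eigenvalue S (spectral_diag S ord0 i).
Proof.
move=> /orthomx_spectralP SE; set Q := spectralmx S in SE *.
have Qu : Q \in unitmx := spectral_unit S.
apply/eigenvalueP; exists (row i Q).
  rewrite [in LHS]SE -row_mul mulmxA mulmxA mulmxV// mul1mx.
  by apply/rowP => j; rewrite !mxE (bigD1 i)//= big1 ?addr0 ?mxE ?eqxx//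
    => k /negPf ki; rewrite mxE eq_sym ki mul0r.
apply: contraTneq Qu => Q0; rewrite -row_free_unit; apply/negP => Qf.
have := row_freeP Qf => -[Q' /(congr1 (row i))].
rewrite row_mul Q0 mul0mx => /rowP/(_ i); rewrite !mxE eqxx => /esym/eqP.
by rewrite oner_eq0.
Qed.

(** In the coordinates of a unitary diagonalization, which preserve [sqnorm], [S] multiplies each
    entry by an eigenvalue of modulus at most [r]. *)
Lemma hermitian_contraction n (S : 'M[C]_n) (r : C) (w : 'cV[C]_n) :
  S^t* = S -> (forall lambda, eigenvalue S lambda -> `|lambda| <= r) ->
  sqnorm (S *m w) <= r ^+ 2 * sqnorm w.
Proof.
move=> /hermitian_normal Sn Sr.
have /orthomx_spectralP SE := Sn.
have Qu := spectral_unitarymx S; have eS := spectral_diag_eigenvalue _ Sn.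
rewrite [S in S *m w]SE invmx_unitary// -!mulmxA.
rewrite sqnorm_unitary ?trmxC_unitary// -[in leRHS](sqnorm_unitary w Qu).
rewrite !sqnormE mulr_sumr ler_sum// => i _.
rewrite mul_diag_mx mxE normrM exprMn ler_wpM2r ?exprn_ge0//.
by rewrite lerXn2r ?nnegrE ?(le_trans _ (Sr _ (eS i))) ?Sr.
Qed.

(** Diagonalize [A] as [Q^t* D Q] with [Q] unitary and take [Q^t*] times the square root of [D]. *)
Lemma psd_factor n (A : 'M[C]_n) : A^t* = A ->
  (forall w : 'cV_n, 0 <= (w^t* *m A *m w) ord0 ord0) ->
  exists L : 'M[C]_n, A = L *m L^t*.
Proof.
move=> hA A0; have /orthomx_spectralP AE := hermitian_normal hA.
have Qu := spectral_unitarymx A.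
set Q := spectralmx A in AE Qu; set D := spectral_diag A in AE.
have D0 i : 0 <= D ord0 i.
  (* The [i]-th column of [Q^t*] is an eigenvector, at which the quadratic form takes the value
     [D ord0 i]. *)
  have := A0 (Q^t* *m delta_mx i ord0).
  rewrite AE invmx_unitary// trmx_mul map_mxM trmxCK !mulmxA mulmxtVK//.
  rewrite (mulmxtVK _ Qu) -colE trmx_delta map_delta_mx -rowE !mxE eqxx.
  by rewrite mulr1n.
pose s := \row_i sqrtC (D ord0 i).
exists (Q^t* *m diag_mx s).
have ss : (diag_mx s)^t* = diag_mx s.
  rewrite tr_diag_mx map_diag_mx; congr diag_mx; apply/rowP => i; rewrite !mxE.
  by apply: conj_Creal; rewrite ger0_real// sqrtC_ge0.
rewrite trmx_mul map_mxM trmxCK ss !mulmxA -[_ *m diag_mx s *m diag_mx s]mulmxA.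
rewrite mulmx_diag [LHS]AE invmx_unitary//; congr (_ *m diag_mx _ *m _).
by apply/rowP => i; rewrite !mxE -expr2 sqrtCK.
Qed.

End hermitian_matrices.

(** If [r] is a row eigenvector of [1 - Y X], then [r Y] is one of [1 - X Y] for the same [lambda],
    unless [r Y = 0], which forces [lambda = 1]. *)
Lemma eigenvalue_1subMC (F : fieldType) n (X Y : 'M[F]_n) (lambda : F) :
  eigenvalue (1%:M - Y *m X) lambda -> eigenvalue (1%:M - X *m Y) lambda.
Proof.
move=> /eigenvalueP[r]; rewrite mulmxBr mulmx1 => rE r0.
have [rY0|rY0] := eqVneq (r *m Y) 0; last first.
  apply/eigenvalueP; exists (r *m Y) => //.
  by rewrite mulmxBr mulmx1 !mulmxA -mulmxBl -(mulmxA r) rE -scalemxAl.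
move: rE; rewrite mulmxA rY0 mul0mx subr0 -[in LHS](scale1r r) => /eqP.
rewrite -subr_eq0 -scalerBl scaler_eq0 (negPf r0) orbF subr_eq0 => /eqP <-.
(* The eigenvalue is now 1 and [r] is a kernel vector of [Y X]. As [X Y] has the same determinant,
   it is singular too, and [1 - X Y] fixes its kernel vectors. *)
have /rowV0Pn[v /sub_kermxP vXY v0] : kermx (X *m Y) != 0.
  rewrite kermx_eq0 row_free_unit unitmxE det_mulmx mulrC -det_mulmx -unitmxE.
  apply: contra r0 => YXu.
  by rewrite -(mulmxK YXu r) mulmxA rY0 !mul0mx.
by apply/eigenvalueP; exists v; rewrite // mulmxBr mulmx1 vXY subr0 scale1r.
Qed.

(** A square matrix and its transpose are singular together, so a row eigenvector yields a column
    one. *)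
Lemma eigenvalue_col (F : fieldType) n (M : 'M[F]_n) (lambda : F) :
  eigenvalue M lambda -> exists2 v : 'cV_n, M *m v = lambda *: v & v != 0.
Proof.
rewrite /eigenvalue kermx_eq0 row_free_unit -unitmx_tr -row_free_unit -kermx_eq0.
move=> /rowV0Pn[v /sub_kermxP]; rewrite linearB/= tr_scalar_mx => vE v0.
exists v^T; last by rewrite trmx_eq0.
apply: trmx_inj; rewrite trmx_mul trmxK linearZ/= trmxK.
by move/eqP: vE; rewrite mulmxBr mul_mx_scalar subr_eq0 => /eqP.
Qed.

(** * Spectral radius and operator norm *)

Section euclidean.
Variable R : realType.

Lemma dotcE n (x y : 'cV[R]_n) : dotc x y = (x^T *m y) ord0 ord0.
Proof. by rewrite mxE; apply: eq_bigr => i _; rewrite mxE. Qed.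

Lemma dotcC n (x y : 'cV[R]_n) : dotc x y = dotc y x.
Proof. by apply: eq_bigr => i _; rewrite mulrC. Qed.

Lemma dotcDl n (x y z : 'cV[R]_n) : dotc (x + y) z = dotc x z + dotc y z.
Proof. by rewrite !dotcE linearD mulmxDl mxE. Qed.

Lemma dotcZl n k (x z : 'cV[R]_n) : dotc (k *: x) z = k * dotc x z.
Proof. by rewrite !dotcE linearZ/= -scalemxAl mxE. Qed.

Lemma dotc_ge0 n (x : 'cV[R]_n) : 0 <= dotc x x.
Proof. by apply: sumr_ge0 => i _; rewrite -expr2 sqr_ge0. Qed.

Lemma sqr_norm2 n (x : 'cV[R]_n) : norm2 x ^+ 2 = dotc x x.
Proof. by rewrite sqr_sqrtr// dotc_ge0. Qed.

Lemma norm2Z n k (x : 'cV[R]_n) : norm2 (k *: x) = `|k| * norm2 x.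
Proof.
by rewrite /norm2 dotcZl dotcC dotcZl mulrA -expr2 sqrtrM ?sqr_ge0// sqrtr_sqr.
Qed.

Lemma norm2_eq0 n (x : 'cV[R]_n) : norm2 x = 0 -> x = 0.
Proof.
move=> /(congr1 (fun t => t ^+ 2)); rewrite sqr_norm2 expr0n/= => /eqP.
rewrite psumr_eq0 => [/allP x0|i _]; last by rewrite -expr2 sqr_ge0.
apply/colP => i; have := x0 i (mem_index_enum _).
by rewrite -expr2 sqrf_eq0 mxE => /eqP.
Qed.

Lemma le_coord_norm2 n (x : 'cV[R]_n) i : `|x i ord0| <= norm2 x.
Proof.
rewrite -sqrtr_sqr ler_sqrt ?dotc_ge0// /dotc (bigD1 i)//= -expr2 lerDl.
by rewrite sumr_ge0// => j _; rewrite -expr2 sqr_ge0.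
Qed.

(** The supremum is meaningful only for a bounded set. The entries of a unit vector have modulus at
    most 1, so entry [i] of [M *m v] is bounded by the absolute row sum. *)
Lemma opnorm2_has_ub n (M : 'M[R]_n) :
  has_ubound [set norm2 (M *m v) | v in [set v | norm2 v = 1]].
Proof.
exists (Num.sqrt (\sum_i (\sum_j `|M i j|) ^+ 2)) => _ [v /= v1 <-].
rewrite ler_sqrt ?sumr_ge0// => [|i _]; last exact: sqr_ge0.
apply: ler_sum => i _; rewrite -expr2 -[leLHS]real_normK ?num_real//.
rewrite lerXn2r ?nnegrE ?sumr_ge0// mxE (le_trans (ler_norm_sum _ _ _))//.
apply: ler_sum => j _; rewrite normrM ler_piMr// -v1; exact: le_coord_norm2.
Qed.

(** The empty set, with [sup] equal to 0, occurs in dimension 0, where there is neither a unit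
    vector nor an eigenvalue. *)
Lemma sup_ge0 (S : set R) : (forall x, S x -> 0 <= x) -> has_ubound S ->
  0 <= sup S.
Proof.
move=> S0 Sub; have [->|/set0P[x Sx]] := eqVneq S set0; first by rewrite sup0.
by rewrite (le_trans (S0 _ Sx))// ub_le_sup.
Qed.

Lemma opnorm2_ge0 n (M : 'M[R]_n) : 0 <= opnorm2 M.
Proof.
by apply: sup_ge0 (opnorm2_has_ub M) => _ [v _ <-]; exact: sqrtr_ge0.
Qed.

Lemma norm2_mulmx n (M : 'M[R]_n) (v : 'cV_n) :
  norm2 (M *m v) <= opnorm2 M * norm2 v.
Proof.
have [v0|v0] := eqVneq (norm2 v) 0.
  by rewrite (norm2_eq0 v0) mulmx0 -(scale0r 0) norm2Z normr0 mul0r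
    mulr_ge0 ?opnorm2_ge0 ?sqrtr_ge0.
have vp : 0 < norm2 v by rewrite lt_def v0 sqrtr_ge0.
rewrite -ler_pdivrMr// mulrC -[_^-1]ger0_norm ?invr_ge0 ?sqrtr_ge0//.
rewrite -norm2Z scalemxAr; apply: ub_le_sup (opnorm2_has_ub M) _ _.
exists ((norm2 v)^-1 *: v) => //=.
by rewrite norm2Z ger0_norm ?invr_ge0 ?sqrtr_ge0// mulVf.
Qed.

Local Notation toC := (map_mx (real_complex R)).

Lemma normc_norm (z : R[i]) : (ComplexField.Normc.normc z)%:C%C = `|z|.
Proof. by []. Qed.

(** The eigenvector may be complex while [opnorm2] tests real vectors only. A real matrix acts
    separately on the real and imaginary parts [x] and [y], and the squared norms add up. *)
Lemma eigenvalue_le_opnorm2 n (M : 'M[R]_n) (lambda : R[i]) :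
  eigenvalue (toC M) lambda -> ComplexField.Normc.normc lambda <= opnorm2 M.
Proof.
move=> /eigenvalue_col[v vE v0].
pose x := \col_i complex.Re (v i ord0); pose y := \col_i complex.Im (v i ord0).
have sq (w : 'cV[R[i]]_n) : sqnorm w =
    (dotc (\col_i complex.Re (w i ord0)) (\col_i complex.Re (w i ord0)) +
     dotc (\col_i complex.Im (w i ord0)) (\col_i complex.Im (w i ord0)))%:C%C.
  rewrite sqnormE /dotc -big_split/= rmorph_sum/=; apply: eq_bigr => i _.
  by rewrite -add_Re2_Im2 !mxE.
have MvR : \col_i complex.Re ((toC M *m v) i ord0) = M *m x.
  apply/colP => i; rewrite !mxE raddf_sum/=; apply: eq_bigr => j _.
  by rewrite !mxE; case: (v j ord0) => a b /=; rewrite mul0r subr0.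
have MvI : \col_i complex.Im ((toC M *m v) i ord0) = M *m y.
  apply/colP => i; rewrite !mxE raddf_sum/=; apply: eq_bigr => j _.
  by rewrite !mxE; case: (v j ord0) => a b /=; rewrite mul0r addr0.
have : sqnorm (toC M *m v) <= (opnorm2 M ^+ 2)%:C%C * sqnorm v.
  rewrite !sq MvR MvI -rmorphM/= lecR mulrDr lerD// -!sqr_norm2 -exprMn;
  by rewrite lerXn2r ?nnegrE ?mulr_ge0 ?opnorm2_ge0 ?sqrtr_ge0// norm2_mulmx.
have -> : sqnorm (toC M *m v) = `|lambda| ^+ 2 * sqnorm v.
  rewrite vE !sqnormE mulr_sumr; apply: eq_bigr => i _.
  by rewrite mxE normrM exprMn.
have v_gt0 : 0 < sqnorm v.
  rewrite lt_def sqnorm_ge0 andbT; apply: contra v0.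
  rewrite sqnormE psumr_eq0 => [/allP v0|i _]; last by rewrite exprn_ge0.
  apply/eqP/colP => i; have := v0 i (mem_index_enum _).
  by rewrite sqrf_eq0 normr_eq0 mxE => /eqP.
rewrite ler_pM2r// -normc_norm -rmorphXn/= lecR.
by rewrite ler_sqr ?nnegrE ?opnorm2_ge0 ?sqrtr_ge0//; case: (lambda) => a b;
  exact: sqrtr_ge0.
Qed.

Lemma normc_ge0 (z : R[i]) : 0 <= ComplexField.Normc.normc z.
Proof. by case: z => a b; exact: sqrtr_ge0. Qed.

Lemma spectral_radius_has_ub n (M : 'M[R]_n) :
  has_ubound [set r : R | exists2 lambda : R[i],
         eigenvalue (toC M) lambda & r = ComplexField.Normc.normc lambda].
Proof.
by exists (opnorm2 M) => _ [lambda ? ->]; exact: eigenvalue_le_opnorm2.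
Qed.

Lemma spectral_radius_ge0 n (M : 'M[R]_n) : 0 <= spectral_radius M.
Proof.
by apply: sup_ge0 (spectral_radius_has_ub M) => _ [z _ ->]; exact: normc_ge0.
Qed.

Lemma spectral_radius_le_opnorm2 n (M : 'M[R]_n) :
  spectral_radius M <= opnorm2 M.
Proof.
rewrite /spectral_radius; set S := [set _ | _].
have [->|S0] := eqVneq S set0; first by rewrite sup0 opnorm2_ge0.
apply: ge_sup; first exact/set0P.
by move=> _ [lambda ? ->]; exact: eigenvalue_le_opnorm2.
Qed.

Lemma eigenvalue_le_spectral_radius n (M : 'M[R]_n) (lambda : R[i]) :
  eigenvalue (toC M) lambda ->
  ComplexField.Normc.normc lambda <= spectral_radius M.
Proof.
by move=> ?; apply: ub_le_sup (spectral_radius_has_ub M) _ _; exists lambda.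
Qed.

End euclidean.

(** * The energy norm *)

Section energy.
Variable R : realType.
Local Open Scope sesquilinear_scope.
Local Notation toC := (map_mx (real_complex R)).

Definition psd n (A : 'M[R]_n) : Prop := forall v, 0 <= dotc (A *m v) v.

Lemma energyC n (A : 'M[R]_n) (x y : 'cV_n) : A^T = A ->
  dotc (A *m x) y = dotc (A *m y) x.
Proof. by move=> sA; rewrite dotcE trmx_mul sA -mulmxA -dotcE dotcC. Qed.

Lemma sqr_energy_norm n (A : 'M[R]_n) (x : 'cV_n) : psd A ->
  energy_norm A x ^+ 2 = dotc (A *m x) x.
Proof. by move=> A0; rewrite sqr_sqrtr. Qed.

Lemma energy_lincomb n (A : 'M[R]_n) (x y : 'cV_n) (s t : R) : A^T = A ->
  dotc (A *m (s *: x + t *: y)) (s *: x + t *: y) =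
  s ^+ 2 * dotc (A *m x) x + 2 * s * t * dotc (A *m x) y +
  t ^+ 2 * dotc (A *m y) y.
Proof.
move=> sA; rewrite mulmxDr -!scalemxAr dotcDl !dotcZl.
rewrite ![dotc _ (s *: x + t *: y)]dotcC !dotcDl !dotcZl.
rewrite [dotc y _]dotcC [dotc x (A *m y)]dotcC (energyC y x sA) ![dotc _ (A *m _)]dotcC.
by ring.
Qed.

Lemma energy_cauchy_schwarz n (A : 'M[R]_n) (x y : 'cV_n) : A^T = A -> psd A ->
  dotc (A *m x) y <= energy_norm A x * energy_norm A y.
Proof.
move=> sA A0; set b := dotc _ _.
have q s t := A0 (s *: x + t *: y).
have {}q s t : 0 <= s ^+ 2 * energy_norm A x ^+ 2 + 2 * s * t * b
                    + t ^+ 2 * energy_norm A y ^+ 2.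
  by rewrite !sqr_energy_norm// -energy_lincomb.
have X0 : 0 <= energy_norm A x := sqrtr_ge0 _.
have Y0 : 0 <= energy_norm A y := sqrtr_ge0 _.
move: (energy_norm A x) (energy_norm A y) X0 Y0 q => X Y X0 Y0 q.
have [Y00|Y00] := eqVneq Y 0.
  rewrite Y00 mulr0; rewrite leNgt; apply/negP => b0.
  (* With [Y = 0] the form is affine in [t]; this [t] gives it the negative value [- X ^+ 2 - 2]. *)
  have := q 1 (- (X ^+ 2 + 1) / b); rewrite Y00.
  rewrite (_ : _ + _ = - X ^+ 2 - 2); last by field; rewrite gt_eqF.
  by have := sqr_ge0 X; lra.
have Yp : 0 < Y by rewrite lt_def Y00.
rewrite leNgt; apply/negP => bXY.
(* Up to scaling, the minimizer of the quadratic form along the line [x + t y]. *)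
have := q (Y ^+ 2) (- b).
rewrite (_ : _ + _ = Y ^+ 2 * ((X * Y) ^+ 2 - b ^+ 2)); last by ring.
rewrite pmulr_rge0 ?exprn_gt0// leNgt subr_lt0.
by rewrite ltr_pXn2r ?bXY ?nnegrE ?mulr_ge0// ltW// (le_lt_trans _ bXY)// mulr_ge0.
Qed.

Lemma energy_normD n (A : 'M[R]_n) (x y : 'cV_n) : A^T = A -> psd A ->
  energy_norm A (x + y) <= energy_norm A x + energy_norm A y.
Proof.
move=> sA A0; rewrite -ler_sqr ?nnegrE ?addr_ge0 ?sqrtr_ge0//.
have := energy_lincomb x y 1 1 sA; rewrite !scale1r sqr_energy_norm// => ->.
rewrite sqrrD !sqr_energy_norm// expr1n !mul1r !mulr1 lerD2r lerD2l -[leRHS]mulr_natl.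
by rewrite ler_pM2l// energy_cauchy_schwarz.
Qed.

Lemma toC_adjoint m n (M : 'M[R]_(m, n)) : (toC M)^t* = toC M^T.
Proof.
by apply/matrixP => i j; rewrite !mxE conj_Creal//; apply/complex_realP; exists (M j i).
Qed.

(** For [w = x + i y] the symmetry of [A] cancels the cross terms, leaving the real forms at [x] and
    at [y]. *)
Lemma toC_psd n (A : 'M[R]_n) : A^T = A -> psd A ->
  forall w : 'cV[R[i]]_n, 0 <= (w^t* *m toC A *m w) ord0 ord0.
Proof.
move=> sA A0 w.
pose x := \col_i complex.Re (w i ord0); pose y := \col_i complex.Im (w i ord0).
have wE : w = toC x + 'i%C *: toC y.
  by apply/colP => i; rewrite !mxE [LHS]complexE.
have -> : (w^t* *m toC A *m w) ord0 ord0 =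
   (dotc (A *m x) x + dotc (A *m y) y)%:C%C.
  have wC : w^t* = toC x^T - 'i%C *: toC y^T.
    rewrite {1}wE !linearD/= linearZ/= map_mxD map_mxZ/= !toC_adjoint.
    rewrite -scaleNr; congr (_ + _ *: _).
    by apply/eqP; rewrite eq_complex/= oppr0 !eqxx.
  rewrite wC {1}wE mulmxBl !mulmxDr !mulmxBl -!scalemxAr -!scalemxAl.
  rewrite -!map_mxM/=.
  rewrite scalerA -expr2 sqr_i scaleN1r opprK.
  have -> : y^T *m A *m x = x^T *m A *m y.
    apply/matrixP => i j; rewrite !ord1 -!mulmxA -!dotcE.
    by rewrite dotcC energyC// dotcC.
  rewrite addrA subrK !dotcE !trmx_mul !sA rmorphD/= mxE.
  by congr (_ + _); rewrite mxE.
by rewrite lecR addr_ge0.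
Qed.

Lemma energy_contraction n (A B : 'M[R]_n) (v : 'cV_n) :
  A^T = A -> psd A -> B^T = B ->
  energy_norm A ((1%:M - B *m A) *m v) <=
  spectral_radius (1%:M - B *m A) * energy_norm A v.
Proof.
move=> sA A0 sB.
have hA : (toC A)^t* = toC A by rewrite toC_adjoint sA.
have [L AL] := psd_factor hA (toC_psd sA A0).
have [S SE] : exists S, S = 1%:M - L^t* *m toC B *m L.
  by exists (1%:M - L^t* *m toC B *m L).
have hS : S^t* = S.
  rewrite SE !linearB/= map_mxB trmx1 map_mx1; congr (_ - _).
  by rewrite !trmx_mul !map_mxM trmxCK toC_adjoint sB !mulmxA.
have toCE : toC (1%:M - B *m A) = 1%:M - toC B *m L *m L^t*.
  by rewrite map_mxB map_mx1 map_mxM AL mulmxA.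
(* Exchanging the factors [L^t*] and [toC B *m L] turns an eigenvalue of [S] into one of the error
   propagation matrix. *)
have Srho lambda : eigenvalue S lambda ->
    `|lambda| <= (spectral_radius (1%:M - B *m A))%:C%C.
  rewrite SE -mulmxA => /eigenvalue_1subMC; rewrite -toCE => eM.
  by rewrite -normc_norm lecR eigenvalue_le_spectral_radius.
(* The energy norm of [w] is the Euclidean norm of [L^t* w]. *)
have energyE (w : 'cV_n) : (dotc (A *m w) w)%:C%C = sqnorm (L^t* *m toC w).
  rewrite /sqnorm trmx_mul map_mxM trmxCK toC_adjoint !mulmxA -(mulmxA _ L) -AL.
  by rewrite -!map_mxM/= mxE dotcE trmx_mul sA.
rewrite -ler_sqr ?nnegrE ?mulr_ge0 ?spectral_radius_ge0 ?sqrtr_ge0//.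
rewrite exprMn !sqr_energy_norm// -lecR rmorphM/= !energyE rmorphXn/=.
have LS : L^t* *m toC (1%:M - B *m A) = S *m L^t*.
  rewrite SE toCE mulmxBr mulmxBl mulmx1 mul1mx; congr (_ - _).
  by rewrite mulmxA mulmxA.
rewrite map_mxM [X in sqnorm X]mulmxA LS -[X in sqnorm X]mulmxA.
exact: hermitian_contraction hS Srho.
Qed.

(** Any [rho] from the spectral radius up to 1 is allowed, so that the spectral radius and the
    operator norm are treated at once. *)
Lemma algebraic_error_bound n (A B : 'M[R]_n) (b u : 'cV_n)
    (uk : nat -> 'cV_n) (rho : R) (k : nat) :
  A^T = A -> psd A -> B^T = B -> A *m u = b ->
  (forall k, uk k.+1 = uk k + B *m (b - A *m uk k)) ->
  spectral_radius (1%:M - B *m A) <= rho -> rho < 1 ->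
  energy_norm A (u - uk k.+1) <=
    rho / (1 - rho) * energy_norm A (uk k.+1 - uk k).
Proof.
move=> sA A0 sB Au ukS rho_ge rho1.
have errS : u - uk k.+1 = (1%:M - B *m A) *m (u - uk k).
  by rewrite ukS -Au -mulmxBr mulmxBl mul1mx mulmxA opprD addrA.
have rho0 : 0 <= rho by rewrite (le_trans _ rho_ge)// spectral_radius_ge0.
have contr : energy_norm A (u - uk k.+1) <= rho * energy_norm A (u - uk k).
  rewrite errS (le_trans (energy_contraction _ sA A0 sB))//.
  by rewrite ler_wpM2r ?sqrtr_ge0.
have tri : energy_norm A (u - uk k) <=
    energy_norm A (u - uk k.+1) + energy_norm A (uk k.+1 - uk k).
  by rewrite -{1}(subrK (uk k.+1) u) -addrA energy_normD.
(* Inserting [tri] in [contr] and moving [rho] times the new error to the left leaves the factor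
   [1 - rho > 0] there. *)
rewrite mulrAC ler_pdivlMr ?subr_gt0// mulrBr mulr1 lerBlDr.
by rewrite (le_trans contr)// [_ (u - uk k.+1) * rho]mulrC -mulrDr
  ler_wpM2l// [leRHS]addrC.
Qed.

End energy.

(** * Integrals of piecewise constant functions *)

Section cellwise_constant_integrals.
Context {R : realType} {d : nat}.
Local Notation V := 'rV[R]_d.
Local Notation RT := (measurableTypeR R).
Implicit Types (T : mesh R d) (h : V -> R).

(** This links the topology of row vectors to the product sigma-algebra of tuples: an open set is
    the countable union of the rational boxes inside it. *)
Lemma measurable_row_of_open (U : set V) : open U ->
  measurable (row_of @^-1` U : set (d.-tuple RT)).
Proof.
move=> oU.
pose box (p : 'rV[rat]_d * rat) : set V :=
  [set x | forall i, `|x ord0 i - ratr (p.1 ord0 i)| < ratr p.2].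
pose F (p : 'rV[rat]_d * rat) : set (d.-tuple RT) :=
  if `[< box p `<=` U >] then row_of @^-1` box p else set0.
have -> : row_of @^-1` U = \bigcup_p F p.
  apply/seteqP; split => [t Ut|t [p _]]; last first.
    by rewrite /F; case: asboolP => // pU; exact: pU.
  have /nbhs_ballP[e /= e0 eU] := open_nbhs_nbhs (conj oU Ut).
  (* A box of radius [r] that contains the point lies within [2 r < e] of it. *)
  have [r re] : exists r : rat, 0 < (ratr r : R) < e / 2.
    have ne : (`]0, e / 2[%classic : set R) !=set0.
      by exists (e / 4); rewrite /= in_itv/=; apply/andP; split; lra.
    have [x [+ [r _ rx]]] := @dense_rat R _ ne (@itv_open _ R 0 (e / 2)).
    by rewrite /= in_itv/= -rx => ?; exists r.
  have /andP[r0 rlt] := re.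
  have qE i : exists q : rat, `|row_of t ord0 i - ratr q| < ratr r :> R.
    have ne : ball (row_of t ord0 i) (ratr r : R) !=set0.
      by exists (row_of t ord0 i); exact: ballxx.
    have [x [+ [q _ qx]]] := @dense_rat R _ ne (@ball_open _ _ _ _).
    by rewrite -qx; exists q.
  have [q qP] := choice qE.
  exists (\row_i q i, r) => //; rewrite /F; case: asboolP => [_ i|]; last first.
    move=> nbU; exfalso; apply: nbU => x /= xb.
    apply: eU; split => // i j; rewrite ord1 /ball/=.
    rewrite (le_lt_trans (ler_distD (ratr (q j)) _ _))//.
    have := xb j; have := qP j; rewrite !mxE distrC [`|ratr _ - x _ _|]distrC.
    by lra.
  by rewrite /= mxE; exact: qP.
apply: (@countable_bigcupT_measurable _ _ _ F) => [|p]; first exact: countableP.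
rewrite /F; case: asboolP => // _.
have -> : row_of @^-1` box p =
    \bigcap_(i in [set: 'I_d]) [set t : d.-tuple RT |
       ball (ratr (p.1 ord0 i) : R) (ratr p.2) (tnth t i)].
  apply/seteqP; split => t /= tp i; have := tp i;
    by rewrite /ball/= mxE distrC// => /(_ I).
apply: fin_bigcap_measurable => // i _.
rewrite -[X in measurable X]setTI.
exact: (@measurable_tnth _ RT d i measurableT _ (open_measurable (@ball_open R R _ _))).
Qed.

(** Induction on the dimension: the measure is built one factor at a time, and a box splits as an
    interval times a smaller box. *)
Lemma lebesgue_tuple_box_lty n (M : R) :
  measurable [set t : n.-tuple RT | forall i, `|tnth t i| <= M] /\
  (@lebesgue_tuple R n [set t | forall i, (`|tnth t i| <= M)%R] < +oo)%E.
Proof.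
have mbox k : measurable [set t : k.-tuple RT | forall i, `|tnth t i| <= M].
  have -> : [set t : k.-tuple RT | forall i, `|tnth t i| <= M] =
      \bigcap_(i in [set: 'I_k]) [set t : k.-tuple RT |
         `[(- M), M]%classic (tnth t i)].
    apply/seteqP; split => t /= tp i; have := tp i; rewrite /= in_itv/= ler_norml//.
    by move=> /(_ I).
  apply: fin_bigcap_measurable => // i _.
  rewrite -[X in measurable X]setTI.
  exact: (@measurable_tnth _ RT k i measurableT _ (measurable_itv _)).
split; first exact: mbox.
elim: n => [|n IH] /=; first by rewrite diracE; case: (_ \in _); rewrite ltry.
rewrite /product_step/= /pushforward.
have -> : @tcons _ RT n @^-1` [set t : n.+1.-tuple RT | forall i, `|tnth t i| <= M] =
    `[(- M), M]%classic `*` [set t : n.-tuple RT | forall i, `|tnth t i| <= M].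
  apply/seteqP; split => -[x t] /=.
    move=> xtM; split => [|i].
      by have := xtM ord0; rewrite in_itv/= ler_norml.
    by have := xtM (lift ord0 i); rewrite tnthS.
  move=> [xM tM] i; case: (unliftP ord0 i) => [j ->|->]; first by rewrite tnthS.
  by move: xM; rewrite in_itv/= ler_norml.
have itv_lty : (@lebesgue_measure R `[(- M)%R, M]%classic < +oo)%E.
  by rewrite lebesgue_measure_itv/=; case: ifPn => _; rewrite -?EFinB ltry.
rewrite [ltLHS](@product_measure1E _ _ RT (n.-tuple RT) R lebesgue_measure
  (lebesgue_tuple n) _ _ (measurable_itv _) (mbox n)).
by rewrite lte_mul_pinfty// ge0_fin_numE.
Qed.

Lemma hull_bounded T (S : {set 'I_(nvert T)}) (x : V) i : hull S x ->
  `|x ord0 i| <= \sum_(j < nvert T) `|vtx j ord0 i|.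
Proof.
move=> [w [w0 w1 ->]]; rewrite summxE (le_trans (ler_norm_sum _ _ _))//.
rewrite big_mkcond ler_sum// => j _; case: ifPn => // jS.
rewrite mxE normrM ler_piMl// ger0_norm// -w1 (bigD1 j)//= lerDl.
by rewrite sumr_ge0.
Qed.

Lemma measurable_off_skeleton T :
  measurable (row_of @^-1` (off_skeleton T) : set (d.-tuple RT)).
Proof.
apply: measurable_row_of_open; apply: bigcup_open => K _; exact: open_interior.
Qed.

Lemma off_skeleton_lty T :
  (@lebesgue_tuple R d (row_of @^-1` (off_skeleton T)) < +oo)%E.
Proof.
pose M : R := \sum_i \sum_(j < nvert T) `|vtx j ord0 i|.
have [mM] := lebesgue_tuple_box_lty d M; apply: le_lt_trans.
apply: le_measure; rewrite ?inE//; first exact: measurable_off_skeleton.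
move=> t [K _ /interior_subset hKt] i /=.
have := hull_bounded i hKt; rewrite mxE => /le_trans; apply.
by rewrite /M (bigD1 i)//= lerDl sumr_ge0// => j _; rewrite sumr_ge0.
Qed.

Lemma piecewise_constant_choice T h : piecewise_constant T h ->
  exists c : {set 'I_(nvert T)} -> R, forall K, K \in cells T ->
    forall x, interior (hull K) x -> h x = c K.
Proof.
move=> hpc; suff /choice[c cP] : forall K, exists c, K \in cells T ->
    forall x, interior (hull K) x -> h x = c by exists c.
by move=> K; have [/hpc[c cP]|_] := boolP (K \in cells T); [exists c|exists 0].
Qed.

(** Linearity of the integral requires integrability. The preimage of [Y] is the finite union of the
    cell interiors whose constant is in [Y]; the function is bounded and the domain has finite
    measure. *)
Lemma piecewise_constant_integrable T h : piecewise_constant T h ->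
  (@lebesgue_tuple R d).-integrable (row_of @^-1` (off_skeleton T))
    (EFin \o (h \o row_of)).
Proof.
move=> /piecewise_constant_choice[c cP].
apply: measurable_bounded_integrable.
- exact: measurable_off_skeleton.
- exact: off_skeleton_lty.
- move=> _ Y mY.
  have -> : row_of @^-1` off_skeleton T `&` (h \o row_of) @^-1` Y =
      \bigcup_(K in [set` cells T])
        if c K \in Y then row_of @^-1` interior (hull K)
        else set0 : set (d.-tuple RT).
    apply/seteqP; split => t /=.
      move=> [[K /= KT tK] /=]; rewrite (cP K)// => cY.
      by exists K => //; rewrite mem_set.
    move=> [K /= KT]; case: ifPn => // /set_mem cY tK; split; first by exists K.
    by rewrite (cP K).
  apply: fin_bigcup_measurable; first exact: finite_finset.
  move=> K _; case: ifPn => // _.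
  by apply: measurable_row_of_open; exact: open_interior.
- exists (\sum_K `|c K|); split => [|M cM t [K /= KT tK]]; first exact: num_real.
  rewrite /= (cP K)// (le_trans _ (ltW cM))// (bigD1 K)//= lerDl.
  by rewrite sumr_ge0.
Qed.

Lemma integral_onD T h1 h2 :
  piecewise_constant T h1 -> piecewise_constant T h2 ->
  integral_on (off_skeleton T) (fun x => h1 x + h2 x) =
  integral_on (off_skeleton T) h1 + integral_on (off_skeleton T) h2.
Proof.
move=> h1pc h2pc; apply: RintegralD; first exact: measurable_off_skeleton.
  exact: piecewise_constant_integrable h1pc.
exact: piecewise_constant_integrable h2pc.
Qed.

Lemma integral_onZl T k h : piecewise_constant T h ->
  integral_on (off_skeleton T) (fun x => k * h x) =
  k * integral_on (off_skeleton T) h.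
Proof.
move=> hpc; apply: RintegralZl; first exact: measurable_off_skeleton.
exact: piecewise_constant_integrable hpc.
Qed.

Lemma eq_integral_on (D : set V) h1 h2 : (forall x, D x -> h1 x = h2 x) ->
  integral_on D h1 = integral_on D h2.
Proof. by move=> h12; apply: eq_Rintegral => t /set_mem Dt; exact: h12. Qed.

Lemma piecewise_constantZ T k h :
  piecewise_constant T h -> piecewise_constant T (fun x => k * h x).
Proof. by move=> p K /p[c cP]; exists (k * c) => x xK; rewrite cP. Qed.

Lemma piecewise_constant_sum T (I : Type) (s : seq I) (h : I -> V -> R) :
  (forall i, piecewise_constant T (h i)) ->
  piecewise_constant T (fun x => \sum_(i <- s) h i x).
Proof.
move=> hpc K KT; have /choice[c cP] := fun i => hpc i K KT.
by exists (\sum_(i <- s) c i) => x xK; apply: eq_bigr => i _; exact: cP.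
Qed.

Lemma integral_on_lincomb T (I : Type) (s : seq I) (c : I -> R)
    (h : I -> V -> R) : (forall i, piecewise_constant T (h i)) ->
  integral_on (off_skeleton T) (fun x => \sum_(i <- s) c i * h i x) =
  \sum_(i <- s) c i * integral_on (off_skeleton T) (h i).
Proof.
move=> hpc; elim: s => [|i s IH].
  rewrite big_nil (@eq_integral_on _ _ (fun x => 0 * 0)).
    by rewrite integral_onZl ?mul0r// => K _; exists 0.
  by move=> x _; rewrite big_nil mul0r.
rewrite big_cons -IH -integral_onZl// -integral_onD.
- by apply: eq_integral_on => x _; rewrite big_cons.
- exact: piecewise_constantZ.
- by apply: piecewise_constant_sum => j; exact: piecewise_constantZ.
Qed.

End cellwise_constant_integrals.

(** * Piecewise affine functions *)

Section piecewise_affine.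
Context {R : realType} {d : nat}.
Local Notation V := 'rV[R]_d.
Implicit Types (T : mesh R d) (a v w : V -> R).

Definition piecewise_affine T v : Prop :=
  forall K, K \in cells T -> P1 (hull K) v.

Lemma dotrDl n (x y z : 'rV[R]_n) : dotr (x + y) z = dotr x z + dotr y z.
Proof. by rewrite /dotr -big_split; apply: eq_bigr => i _; rewrite mxE mulrDl. Qed.

Lemma dotrZl n k (x z : 'rV[R]_n) : dotr (k *: x) z = k * dotr x z.
Proof. by rewrite /dotr mulr_sumr; apply: eq_bigr => i _; rewrite mxE mulrA. Qed.

Lemma dotrC n (x y : 'rV[R]_n) : dotr x y = dotr y x.
Proof. by apply: eq_bigr => i _; rewrite mulrC. Qed.

Lemma dotr_suml n (I : Type) (s : seq I) (P : pred I) (c : I -> R)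
    (x : I -> 'rV[R]_n) y :
  dotr (\sum_(i <- s | P i) c i *: x i) y = \sum_(i <- s | P i) c i * dotr (x i) y.
Proof.
elim/big_rec2 : _ => [|i k z _ <-]; last by rewrite dotrDl dotrZl.
by rewrite /dotr big1// => i _; rewrite mxE mul0r.
Qed.

Lemma dotr_ge0 n (x : 'rV[R]_n) : 0 <= dotr x x.
Proof. by apply: sumr_ge0 => i _; rewrite -expr2 sqr_ge0. Qed.

Lemma dotr_delta n (x : 'rV[R]_n) i : dotr x (delta_mx ord0 i) = x ord0 i.
Proof.
rewrite /dotr (bigD1 i)//= mxE !eqxx mulr1 big1 ?addr0// => j /negPf ji.
by rewrite mxE ji andbF mulr0.
Qed.

(** Near an interior point the difference quotient is constant, because small steps along a
    coordinate axis remain in [D]. *)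
Lemma grad_affine (D : set V) v b g x : (forall y, D y -> v y = b + dotr g y) ->
  interior D x -> grad v x = g.
Proof.
move=> vE Dx; apply/rowP => i; rewrite mxE /partial.
apply: cvg_lim => //; apply: cvg_near_cst.
have cts : (fun h : R => h *: delta_mx ord0 i + x) @ 0^' --> x.
  have : (fun h : R => h *: delta_mx ord0 i + x) @ 0 -->
      (0 : R) *: delta_mx ord0 i + x.
    by apply: cvgD; [apply: cvgZr_tmp; exact: cvg_id|exact: cvg_cst].
  by rewrite scale0r add0r; exact: cvg_within_filter.
have xD : v x = b + dotr g x by apply: vE; exact: interior_subset.
near=> h; rewrite [(v \o _) _]vE /= ?xD; last by near: h; exact: (cts _ Dx).
rewrite dotrC dotrDl dotrZl [dotr x _]dotrC [dotr _ g]dotrC dotr_delta.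
have h0 : h != 0 by near: h; exact: nbhs_dnbhs_neq.
by rewrite [_ *: _]mulrC; field.
Unshelve. all: by end_near.
Qed.

Lemma grad_piecewise_constant T v K : piecewise_affine T v -> K \in cells T ->
  exists g, forall x, interior (hull K) x -> grad v x = g.
Proof.
by move=> vT /vT[b [g vE]]; exists g => x; exact: grad_affine vE.
Qed.

Lemma grad_lincomb T (I : finType) (c : I -> R) (v : I -> V -> R) w x :
  (forall i, piecewise_affine T (v i)) ->
  (forall K, K \in cells T -> forall y, hull K y -> w y = \sum_i c i * v i y) ->
  off_skeleton T x -> grad w x = \sum_i c i *: grad (v i) x.
Proof.
move=> vT wE [K /= KT xK].
have /choice[b /choice[g vE]] := fun i => vT i K KT.
have -> : \sum_i c i *: grad (v i) x = \sum_i c i *: g i.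
  by apply: eq_bigr => i _; congr (_ *: _); exact: grad_affine (vE i) xK.
apply: (@grad_affine (hull K) _ (\sum_i c i * b i)) => // y yK.
rewrite (wE K)// dotr_suml -big_split/=; apply: eq_bigr => i _.
by rewrite (vE i)// mulrDr.
Qed.

Lemma energy_density_piecewise_constant T a v w : piecewise_constant T a ->
  piecewise_affine T v -> piecewise_affine T w ->
  piecewise_constant T (fun x => a x * dotr (grad v x) (grad w x)).
Proof.
move=> aT vT wT K KT; have [c cE] := aT K KT.
have [g gE] := grad_piecewise_constant vT KT.
have [h hE] := grad_piecewise_constant wT KT.
by exists (c * dotr g h) => x xK; rewrite cE// gE// hE.
Qed.

Lemma aformC T a v w : aform T a v w = aform T a w v.
Proof. by apply: eq_integral_on => x _; rewrite dotrC. Qed.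

(** [w] is compared with the combination on the cells only: the form sees nothing but cell
    interiors, and nodal expansions hold only on cells. *)
Lemma aform_lincomb T (I : finType) (c : I -> R) (v : I -> V -> R) a w u :
  piecewise_constant T a -> (forall i, piecewise_affine T (v i)) ->
  piecewise_affine T u ->
  (forall K, K \in cells T -> forall y, hull K y -> w y = \sum_i c i * v i y) ->
  aform T a w u = \sum_i c i * aform T a (v i) u.
Proof.
move=> aT vT uT wE; rewrite /aform -integral_on_lincomb => [|i]; last first.
  exact: energy_density_piecewise_constant.
apply: eq_integral_on => x xT; rewrite (grad_lincomb vT wE)// dotr_suml mulr_sumr.
by apply: eq_bigr => i _; rewrite mulrCA.
Qed.

Lemma piecewise_affine_lincomb T (I : finType) (c : I -> R) (v : I -> V -> R) w :
  (forall i, piecewise_affine T (v i)) ->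
  (forall K, K \in cells T -> forall y, hull K y -> w y = \sum_i c i * v i y) ->
  piecewise_affine T w.
Proof.
move=> vT wE K KT; have /choice[b /choice[g vE]] := fun i => vT i K KT.
exists (\sum_i c i * b i), (\sum_i c i *: g i) => y yK.
rewrite (wE K)// dotr_suml -big_split/=; apply: eq_bigr => i _.
by rewrite (vE i)// mulrDr.
Qed.

Lemma aform_lincomb2 T n (c : 'cV[R]_n) (v : 'I_n -> V -> R) a w :
  piecewise_constant T a -> (forall i, piecewise_affine T (v i)) ->
  (forall K, K \in cells T -> forall y, hull K y ->
     w y = \sum_i c i ord0 * v i y) ->
  aform T a w w = dotc ((\matrix_(i, j) aform T a (v j) (v i)) *m c) c.
Proof.
move=> aT vT wE; have wT := piecewise_affine_lincomb vT wE.
rewrite (aform_lincomb aT vT wT wE); apply: eq_bigr => i _; rewrite mulrC.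
congr (_ * _); rewrite aformC (aform_lincomb aT vT _ wE)// !mxE.
by apply: eq_bigr => j _; rewrite mxE mulrC.
Qed.

Lemma aform_ge0 T a v : (forall x, off_skeleton T x -> 0 < a x) ->
  0 <= aform T a v v.
Proof.
move=> a0; apply: Rintegral_ge0 => t tT; rewrite mulr_ge0 ?dotr_ge0//.
by rewrite ltW// a0.
Qed.

Lemma sum_indicator (I : finType) (K : {set I}) z : z \in K ->
  \sum_(i in K) (i == z)%:R = 1 :> R.
Proof.
by move=> zK; rewrite (bigD1 z)//= eqxx big1 ?addr0// => i /andP[_ /negPf ->].
Qed.

Lemma sum_scale_indicator (I : finType) (K : {set I}) (F : I -> V) z : z \in K ->
  \sum_(i in K) (i == z)%:R *: F i = F z.
Proof.
move=> zK; rewrite (bigD1 z)//= eqxx scale1r big1 ?addr0// => i /andP[_ /negPf ->].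
by rewrite scale0r.
Qed.

Lemma vertex_in_hull T (K : {set 'I_(nvert T)}) z : z \in K -> hull K (vtx z).
Proof.
move=> zK; exists (fun j => (j == z)%:R); split => //; first exact: sum_indicator.
by rewrite sum_scale_indicator.
Qed.

Lemma affine_hull_eval T (K : {set 'I_(nvert T)}) v (w : 'I_(nvert T) -> R) :
  P1 (hull K) v -> (forall i, 0 <= w i) -> \sum_(i in K) w i = 1 ->
  v (\sum_(i in K) w i *: vtx i) = \sum_(i in K) w i * v (vtx i).
Proof.
move=> [b [g vE]] w0 w1.
have vtxK i : i \in K -> v (vtx i) = b + dotr g (vtx i).
  by move=> iK; apply: vE; exact: vertex_in_hull.
rewrite vE; last by exists w.
rewrite dotrC dotr_suml -{1}(mulr1 b) -w1 mulr_sumr -big_split/=.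
by apply: eq_bigr => i iK; rewrite vtxK// dotrC; ring.
Qed.

End piecewise_affine.

(** * The nodal basis near interior vertices *)

Section mesh_geometry.
Context {R : realType} {d : nat}.
Local Notation V := 'rV[R]_d.
Implicit Types (T : mesh R d) (Om : set V) (a v : V -> R).

(** The hull is the continuous image of a compact set of weights. *)
Lemma hull_closed T (K : {set 'I_(nvert T)}) : closed (hull K).
Proof.
pose simplex := [set w : 'rV[R]_(nvert T) | forall i, `[0, 1]%classic (w ord0 i)] `&`
  (fun w : 'rV[R]_(nvert T) => \sum_(i in K) w ord0 i) @^-1` [set 1].
pose bary (w : 'rV[R]_(nvert T)) : V := \sum_(i in K) w ord0 i *: vtx i.
have coordC i : continuous (fun w : 'rV[R]_(nvert T) => w ord0 i).
  exact: coord_continuous.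
have hullE : hull K = bary @` simplex.
  apply/seteqP; split => [x [w [w0 w1 ->]]|x [w [w01 w1] <-]].
    (* Weights outside [K] have no upper bound in [hull]; setting them to 0 puts every coordinate in
       [[0, 1]]. *)
    exists (\row_i (if i \in K then w i else 0)); last first.
      by apply: eq_bigr => i iK; rewrite mxE iK.
    split => [i|]; last by rewrite /= -[RHS]w1; apply: eq_bigr => i iK; rewrite mxE iK.
    rewrite /= mxE in_itv/=; case: ifPn => iK; last by rewrite lexx ler01.
    by rewrite w0/= -w1 (bigD1 i)//= lerDl sumr_ge0.
  exists (fun i => w ord0 i); split => // i.
  by have := w01 i; rewrite /= in_itv/= => /andP[].
have simplex_compact : compact simplex.
  apply: compact_closedI.
    exact: (@rV_compact R (nvert T) (fun=> `[0, 1]%classic)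
      (fun=> @segment_compact R 0 1)).
  have sumC : continuous (fun w : 'rV[R]_(nvert T) => \sum_(i in K) w ord0 i).
    by apply: continuous_big => //; exact: add_continuous.
  by have /continuous_closedP := sumC; apply; exact: closed_eq.
have baryC : continuous bary.
    apply: continuous_big => [|i _ w]; first exact: add_continuous.
  by apply: (cvgZr_tmp (coordC i w)).
rewrite hullE; apply: compact_closed; first exact: norm_hausdorff.
apply: continuous_compact => //; exact: continuous_subspaceT.
Qed.

Lemma P1_gt_near (D : set V) v (x : V) (r : R) : closed D -> P1 D v -> (D x -> r < v x) ->
  \forall y \near x, D y -> r < v y.
Proof.
move=> Dcl [b [g vE]] rv; have [Dx|nDx] := pselect (D x); last first.
  have : nbhs x (~` D) by exact: open_nbhs_nbhs (conj (closed_openC Dcl) nDx).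
  by apply: filterS => y.
have cts : continuous (fun y : V => b + dotr g y).
  have dotC : continuous (fun y : V => dotr g y).
    apply: continuous_big => [|i _ z]; first exact: add_continuous.
    exact: (cvgM (cvg_cst (g ord0 i)) (@coord_continuous R 1 d ord0 i z)).
  by move=> y; exact: (cvgD (cvg_cst b) (dotC y)).
have : \forall y \near x, r < b + dotr g y.
  have rx : r < b + dotr g x by rewrite -vE// rv.
  exact: cvgr_gt (cts x) _ rx.
by apply: filterS => y ry Dy; rewrite vE.
Qed.

(** One-sided continuity across cells: each closed cell either contains [x] or is avoided by a
    neighbourhood of [x], and there are finitely many cells. *)
Lemma piecewise_affine_gt_near T v (x : V) (r : R) :
  piecewise_affine T v -> r < v x ->
  \forall y \near x, forall K, K \in cells T -> hull K y -> r < v y.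
Proof.
move=> vT rv.
have near_cell (K : {set 'I_(nvert T)}) :
    \forall y \near x, K \in cells T -> hull K y -> r < v y.
  have [KT|KT] := boolP (K \in cells T); last by near=> y.
  have := P1_gt_near (@hull_closed T K) (vT K KT) (fun=> rv).
  by apply: filterS => y yP _.
exact: (filter_forall (nbhs_filter x) near_cell).
Unshelve. all: by end_near. Qed.

Section nodal_basis.
Variables (T : mesh R d) (phi : 'I_(nvert T) -> V -> R).
Hypothesis phi_affine : forall z, piecewise_affine T (phi z).
Hypothesis phi_nodal : forall z z', phi z (vtx z') = (z' == z)%:R.

(** On a cell, [phi z] is the barycentric coordinate at [z]. *)
Lemma nodal_basis_hull (K : {set 'I_(nvert T)}) (w : 'I_(nvert T) -> R) z :
  K \in cells T -> (forall i, 0 <= w i) -> \sum_(i in K) w i = 1 ->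
  phi z (\sum_(i in K) w i *: vtx i) = if z \in K then w z else 0.
Proof.
move=> KT w0 w1; rewrite (affine_hull_eval (phi_affine z KT))//.
case: ifPn => zK.
  rewrite (bigD1 z)//= phi_nodal eqxx mulr1 big1 ?addr0// => i /andP[_ /negPf iz].
  by rewrite phi_nodal iz mulr0.
rewrite big1// => i iK; rewrite phi_nodal; case: eqVneq => [iz|]; last by rewrite mulr0.
by rewrite -iz iK in zK.
Qed.

Lemma nodal_basis_ge0 z x : carrier T x -> 0 <= phi z x.
Proof.
by move=> [K /= KT [w [w0 w1 ->]]]; rewrite nodal_basis_hull//; case: ifP.
Qed.

Lemma nodal_interpolation v K x : piecewise_affine T v -> K \in cells T ->
  hull K x -> v x = \sum_z v (vtx z) * phi z x.
Proof.
move=> vT KT [w [w0 w1 ->]]; rewrite (affine_hull_eval (vT K KT))//.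
rewrite big_mkcond; apply: eq_bigr => z _; rewrite nodal_basis_hull//.
by case: ifP; rewrite ?mulr0// mulrC.
Qed.

(* The homothety [m] of center [vtx z] and ratio [t] maps a neighbourhood of [x]
   into [Om], and [phi z (m x) > 1 - t] there.  So [m y] lies in a cell
   containing [z] with barycentric coordinate exceeding [1 - t] at [z], which
   says that [y] itself lies in that cell. *)
Lemma nodal_basis_gt0_interior Om z x : open Om -> closure Om = carrier T ->
  Om (vtx z) -> carrier T x -> 0 < phi z x -> interior (closure Om) x.
Proof.
move=> oOm OmT zOm [K /= KT xK] phix.
pose m (t : R) (y : V) : V := t *: (y - vtx z) + vtx z.
have [t [t0 t1 mxOm]] : exists t : R, [/\ 0 < t, t <= 1 & Om (m t x)].
  have mC : m ^~ x @ (0 : R) --> vtx z.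
    have : m ^~ x @ (0 : R) --> (0 : R) *: (x - vtx z) + vtx z.
      exact: (cvgD (cvgZr_tmp (@cvg_id _ (nbhs (0 : R)))) (cvg_cst (vtx z))).
    by rewrite scale0r add0r.
  have /nbhs_ballP[e /= e0 eOm] := mC _ (open_nbhs_nbhs (conj oOm zOm)).
  (* [e / 2] keeps [m t x] in [Om]; the cap 1 makes [m t x] a convex combination of [x] and
     [vtx z]. *)
  exists (Num.min 1 (e / 2)); split.
  - by rewrite lt_min ltr01 divr_gt0.
  - by rewrite ge_min lexx.
  apply: eOm; rewrite /ball/= sub0r normrN ger0_norm ?le_min ?ler01 ?divr_ge0 ?ltW//.
  by rewrite gt_min [e / 2 < e]ltr_pdivrMr// mulr_natr mulr2n ltrDl e0 orbT.
have phimx : 1 - t < phi z (m t x).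
  have [w [w0 w1 xE]] := xK.
  have wE : phi z x = if z \in K then w z else 0 by rewrite xE nodal_basis_hull.
  have zK : z \in K by move: phix; rewrite wE; case: ifP; rewrite ?ltxx.
  (* Barycentric coordinates of [m t x]: the one at [z] is [1 - t] plus the positive number
     [t * w z]. *)
  pose w' i := t * w i + (1 - t) * (i == z)%:R.
  have w'0 i : 0 <= w' i.
    by rewrite addr_ge0 ?mulr_ge0 ?subr_ge0 ?ler0n// ltW.
  have w'1 : \sum_(i in K) w' i = 1.
    by rewrite big_split/= -!mulr_sumr w1 sum_indicator//; ring.
  have -> : m t x = \sum_(i in K) w' i *: vtx i.
    under eq_bigr => i _ do rewrite scalerDl -!scalerA.
    rewrite big_split/= -!scaler_sumr -xE sum_scale_indicator// /m scalerBr.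
    by rewrite scalerBl scale1r -addrA [- _ + _]addrC.
  rewrite nodal_basis_hull// zK /w' eqxx mulr1 ltrDr mulr_gt0//.
  by move: phix; rewrite wE zK.
have mC : m t @ x --> m t x.
  have subC : (fun y : V => y - vtx z) @ x --> x - vtx z.
    exact: (cvgB cvg_id (cvg_cst (vtx z))).
  exact: (cvgD (cvgZl_tmp subC) (cvg_cst (vtx z))).
have nOm : nbhs x (m t @^-1` Om).
  exact: mC _ (open_nbhs_nbhs (conj oOm mxOm)).
have nphi := mC _ (piecewise_affine_gt_near (phi_affine z) phimx).
apply: (filterS _ (filterI nOm nphi)) => y /= [yOm yphi].
rewrite OmT; have [K' /= KT' myK] : carrier T (m t y).
  by rewrite -OmT; exact: (subset_closure yOm).
exists K' => //; have := yphi K' KT' myK; have [w [w0 w1 mE]] := myK.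
rewrite mE nodal_basis_hull//; case: ifPn => zK wz; last first.
  by move: wz; rewrite subr_lt0 => /(le_lt_trans t1); rewrite ltxx.
(* The inverse homothety in barycentric coordinates; [wz] makes the coordinate at [z]
   nonnegative. *)
pose w' i := t^-1 * (w i - (1 - t) * (i == z)%:R).
have tN0 : t != 0 by rewrite gt_eqF.
exists w'; split.
- move=> i; rewrite mulr_ge0 ?invr_ge0 ?(ltW t0)// subr_ge0.
  by case: eqVneq => [->|_]; rewrite ?mulr1 ?mulr0// ltW.
- by rewrite -mulr_sumr sumrB w1 -mulr_sumr sum_indicator//; field.
- under eq_bigr => i _ do rewrite -scalerA scalerBl -scalerA.
  rewrite -scaler_sumr sumrB -mE -scaler_sumr sum_scale_indicator//.
  rewrite /m scalerBl scale1r opprB scalerBr -!addrA [vtx z + _]addrCA !addrA.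
  by rewrite subrK addrK scalerA mulVf// scale1r.
Qed.

End nodal_basis.

End mesh_geometry.

(** * The discrete problem *)

Section finite_elements.
Context {R : realType} {d : nat}.
Local Notation V := 'rV[R]_d.
Variables (Om : set V) (T : mesh R d) (a f g : V -> R)
  (phi : 'I_(nvert T) -> V -> R).
Hypothesis a_pc : piecewise_constant T a.
Hypothesis a_gt0 : forall x, off_skeleton T x -> 0 < a x.
Hypothesis phi_lagrange : lagrange_basis Om phi.

Let phi_affine z : piecewise_affine T (phi z).
Proof. by have [[]] := phi_lagrange z. Qed.

Let phi_nodal z z' : phi z (vtx z') = (z' == z)%:R.
Proof. by have [_] := phi_lagrange z. Qed.

Lemma stiffness_sym : (stiffness Om a phi)^T = stiffness Om a phi.
Proof. by apply/matrixP => i j; rewrite !mxE aformC. Qed.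

Lemma aform_stiffness (c : 'cV[R]_(nint Om T)) (w : V -> R) :
  (forall K, K \in cells T -> forall y, hull K y ->
     w y = \sum_i c i ord0 * phi (ivtx i) y) ->
  aform T a w w = dotc (stiffness Om a phi *m c) c.
Proof. exact: aform_lincomb2. Qed.

Lemma stiffness_psd : psd (stiffness Om a phi).
Proof.
move=> c; rewrite -(@aform_stiffness c (fun y => \sum_i c i ord0 * phi (ivtx i) y))//.
exact: aform_ge0.
Qed.

Lemma fun_energy_norm_stiffness (c : 'cV[R]_(nint Om T)) (w : V -> R) :
  (forall K, K \in cells T -> forall y, hull K y ->
     w y = \sum_i c i ord0 * phi (ivtx i) y) ->
  fun_energy_norm T a w = energy_norm (stiffness Om a phi) c.
Proof. by move=> /aform_stiffness wE; rewrite /fun_energy_norm wE. Qed.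

Lemma fe_functionB (c c' : 'cV[R]_(nint Om T)) x :
  fe_function g phi c x - fe_function g phi c' x =
  \sum_i (c - c') i ord0 * phi (ivtx i) x.
Proof.
rewrite /fe_function opprD addrACA subrr addr0 -sumrB; apply: eq_bigr => i _.
by rewrite !mxE mulrBl.
Qed.

Definition nodal_values (v : V -> R) : 'cV[R]_(nint Om T) :=
  \col_i v (vtx (ivtx i)).

Lemma sum_vertices (F : 'I_(nvert T) -> R) :
  \sum_z F z = \sum_(i < nint Om T) F (ivtx i) +
               \sum_(z | z \notin interior_vertices Om T) F z.
Proof.
rewrite (bigID (mem (interior_vertices Om T)))/=; congr (_ + _).
by rewrite [LHS]big_enum_val.
Qed.

Hypothesis Om_domain : polyhedral_domain Om.
Hypothesis T_mesh : triangulation Om T.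

Lemma vertex_in_carrier (z : 'I_(nvert T)) : carrier T (vtx z).
Proof.
have [_ /(_ z)[K KT zK] _ _ _] := T_mesh.
by exists K => //; exact: vertex_in_hull.
Qed.

(** Every vertex lies in [closure Om], and [Om], being open, is its own interior. *)
Lemma boundary_vertex (z : 'I_(nvert T)) : z \notin interior_vertices Om T ->
  boundary Om (vtx z).
Proof.
have [_ _ _ _ OmT] := T_mesh; have [_ [/interior_id OmE _] _ _] := Om_domain.
rewrite inE => zOm; split; first by rewrite OmT; exact: vertex_in_carrier.
by rewrite OmE => /mem_set zOm'; rewrite zOm' in zOm.
Qed.

(** At a boundary point where it were positive, the homothety argument would give a point of
    [interior (closure Om)], which is [Om] since slits are excluded. *)
Lemma interior_basis_S1g (i : 'I_(nint Om T)) : S1g Om T (fun=> 0) (phi (ivtx i)).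
Proof.
have [_ _ _ _ OmT] := T_mesh; have [_ [oOm _] OmE _] := Om_domain.
split; first by have [] := phi_lagrange (ivtx i).
move=> x [xcl xint]; have xT : carrier T x by rewrite -OmT.
apply/eqP; rewrite eq_le (nodal_basis_ge0 phi_affine phi_nodal)// andbT leNgt.
apply/negP => phix; apply: xint; rewrite (interior_id Om).1// -OmE.
have zOm : Om (vtx (ivtx i)).
  by have := enum_valP i; rewrite inE => /set_mem.
exact: (nodal_basis_gt0_interior phi_affine phi_nodal oOm OmT zOm xT phix).
Qed.

Lemma nodal_values_fe_function v K x : S1g Om T g v -> K \in cells T ->
  hull K x -> v x = fe_function g phi (nodal_values v) x.
Proof.
move=> [[_ vT] vg] KT xK.
rewrite (nodal_interpolation phi_affine phi_nodal vT KT xK) sum_vertices.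
congr (_ + _); first by apply: eq_bigr => i _; rewrite mxE.
by apply: eq_bigr => z zOm; rewrite vg//; exact: boundary_vertex.
Qed.

(** Test with the interior basis functions and expand [v] over all vertices; the boundary part of
    the expansion is what [load] subtracts. *)
Lemma galerkin_nodal_values v : galerkin_solution Om T a f g v ->
  stiffness Om a phi *m nodal_values v = load Om a f g phi.
Proof.
move=> [vS vsol]; apply/colP => i; rewrite [RHS]mxE.
rewrite -(vsol _ (interior_basis_S1g i)).
have vE K : K \in cells T -> forall y, hull K y ->
    v y = \sum_z v (vtx z) * phi z y.
  by move=> KT y yK; exact: nodal_interpolation vS.1.2 KT yK.
rewrite (aform_lincomb a_pc phi_affine (phi_affine (ivtx i)) vE) sum_vertices.
rewrite [X in _ = _ + X - _](eq_bigr (fun z =>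
    g (vtx z) * aform T a (phi z) (phi (ivtx i)))).
  by rewrite addrK mxE; apply: eq_bigr => j _; rewrite !mxE mulrC.
by move=> z zOm; rewrite vS.2//; exact: boundary_vertex.
Qed.

End finite_elements.

Theorem theorem4p1 (R : realType) (d : nat) (hd : d = 2%N \/ d = 3%N)
  (Om : set 'rV[R]_d) (hOm : polyhedral_domain Om)
  (T : mesh R d) (hT : triangulation Om T)
  (gamma sigma : R) (hreg : shape_regular T gamma)
  (hqu : quasi_uniform T sigma)
  (a f g : 'rV[R]_d -> R)
  (ha : piecewise_constant T a) (hapos : forall x, off_skeleton T x -> 0 < a x)
  (hf : piecewise_constant T f)
  (hg : exists w, S1 Om T w /\ forall x, boundary Om x -> g x = w x)
  (phi : 'I_(nvert T) -> 'rV[R]_d -> R) (hphi : lagrange_basis Om phi)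
  (uT : 'rV[R]_d -> R) (huT : galerkin_solution Om T a f g uT)
  (u : 'cV[R]_(nint Om T))
  (hu : stiffness Om a phi *m u = load Om a f g phi)
  (B : 'M[R]_(nint Om T)) (hB : B^T = B)
  (uk : nat -> 'cV[R]_(nint Om T))
  (huk : forall k, uk k.+1 =
     uk k + B *m (load Om a f g phi - stiffness Om a phi *m uk k))
  (rho_err : R)
  (hrho : rho_err = spectral_radius (1%:M - B *m stiffness Om a phi) \/
          rho_err = opnorm2 (1%:M - B *m stiffness Om a phi))
  (hconv : rho_err < 1) (k : nat) :
  energy_norm (stiffness Om a phi) (u - uk k.+1) <=
    rho_err / (1 - rho_err) *
    energy_norm (stiffness Om a phi) (uk k.+1 - uk k) /\
  fun_energy_norm T a (fun x => uT x - fe_function g phi (uk k.+1) x) <=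
    rho_err / (1 - rho_err) *
    fun_energy_norm T a (fun x => fe_function g phi (uk k.+1) x -
                                  fe_function g phi (uk k) x).
Proof.
have sA := stiffness_sym Om a phi.
have A0 := stiffness_psd ha hapos hphi.
have rho_ge : spectral_radius (1%:M - B *m stiffness Om a phi) <= rho_err.
  by case: hrho => ->; rewrite ?spectral_radius_le_opnorm2.
(* Stated for any solution [v] of the linear system, to serve both [u] and the nodal values of
   [uT]. *)
have bound v (Av : stiffness Om a phi *m v = load Om a f g phi) :=
  algebraic_error_bound k sA A0 hB Av huk rho_ge hconv.
split; first exact: bound.
have AuT := galerkin_nodal_values ha hphi hOm hT huT.
rewrite (fun_energy_norm_stiffness ha hphi (c := nodal_values Om T uT - uk k.+1)).
  rewrite (fun_energy_norm_stiffness ha hphi (c := uk k.+1 - uk k)).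
    exact: bound.
  by move=> K _ y _; exact: fe_functionB.
move=> K KT y yK.
by rewrite (nodal_values_fe_function hphi hOm hT huT.1 KT yK) fe_functionB.
Qed.
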